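(* There exist positive constants $M_1,M_2,\omega_1,\omega_2$ such that, for solutions $\psi$ of the homogeneous equation $$(-a\mathcal{A}-\partial_t)\bigl(\psi_{tt}(t)+c^2\mathcal{A}\psi(t)+b\mathcal{A}\psi_t(t)\bigr)=0,\qquad \psi(0)=\psi_0,\ \psi_t(0)=\psi_1,\ \psi_{tt}(0)=\psi_2,$$ one has, for all $t\ge 0$, $$E_1[\psi](t)\le M_1\mathrm{e}^{-\omega_1t}E_1[\psi](0)\qquad\text{and}\qquad E_2[\psi](t)\le M_2\mathrm{e}^{-\omega_2t}E_2[\psi](0),$$ where the first estimate refers to solutions with $\Psi(0)\in H_1$ and the second to solutions with $\Psi(0)\in H_2$.
   Context: $\mathcal{H}$ is a (separable) Hilbert space with norm $\|\cdot\|_{\mathcal{H}}$ (in applications $\mathcal{H}=L^2(\Omega)$, $\Omega\subset\mathbb{R}^d$, $d\in\{1,2,3\}$, open and bounded with smooth boundary). $\mathcal{A}:\mathcal{D}(\mathcal{A})\to\mathcal{H}$ is a self-adjoint, strictly positive, closed operator with domain dense in $\mathcal{H}$ (in applications $\mathcal{A}=-\Delta$ with domain $H^2(\Omega)\cap H_0^1(\Omega)$), $\underline{\mu}:=\min\sigma(\mathcal{A})>0$. It is assumed that $\|v\|_{\mathcal{H}}\le C_\nu\|\mathcal{A}^\nu v\|_{\mathcal{H}}$ for $v\in\mathcal{D}(\mathcal{A}^\nu)$, $\nu=\tfrac12,1,\tfrac32$. The constants $a,b,c$ are positive. Spaces: $H_1=\mathcal{D}(\mathcal{A}^{1/2})\times\mathcal{H}\times\mathcal{H}$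 with squared norm $\|\mathcal{A}^{1/2}x_1\|_{\mathcal{H}}^2+\|x_2\|_{\mathcal{H}}^2+\|x_3\|_{\mathcal{H}}^2$, and $H_2=\mathcal{D}(\mathcal{A})\times\mathcal{H}\times\mathcal{H}$ with squared norm $\frac{\alpha^2b^2}{4}\|\mathcal{A}x_1\|_{\mathcal{H}}^2+\|x_2\|_{\mathcal{H}}^2+\|x_3\|_{\mathcal{H}}^2$ for a fixed constant $\alpha>0$. The equation is understood as the first-order system $\Psi_t=A\Psi$, $t>0$, $\Psi(0)=(\psi_0,\psi_1,\psi_2+c^2\mathcal{A}\psi_0+b\mathcal{A}\psi_1)^T\in H_i$ ($i=1,2$), with $\Psi=(\psi,\psi_t,\psi_{tt}+c^2\mathcal{A}\psi+b\mathcal{A}\psi_t)^T$ and $$A=\begin{pmatrix}0&I&0\\-c^2\mathcal{A}&-b\mathcal{A}&I\\0&0&-a\mathcal{A}\end{pmatrix},\qquad\mathcal{D}(A)=\mathcal{D}(\mathcal{A})^3 ;$$ a solution is a function $\Psi$ with values in $H_i$ that is continuous for $t\ge0$, continuously differentiable with $\Psi(t)\in\mathcal{D}(A)$ for $t>0$, and satisfies the system and the initial condition. Energies: $E_1[\psi](t)=\|\mathcal{A}^{1/2}\psi(t)\|_{\mathcal{H}}^2+\|\psi_t(t)\|_{\mathcal{H}}^2+\|\psi_{tt}(t)+c^2\mathcal{A}\psi(t)+b\mathcal{A}\psi_t(t)\|_{\mathcal{H}}^2$, $E_2[\psi](t)=\|\mathcal{A}\psi(t)\|_{\mathcal{H}}^2+\|\psi_t(t)\|_{\mathcal{H}}^2+\|\psi_{tt}(t)+c^2\mathcal{A}\psi(t)+b\mathcal{A}\psi_t(t)\|_{\mathcal{H}}^2$.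 *)

(* Defs.v *)
From HB Require Import structures.
From mathcomp Require Import all_boot all_order all_algebra.
From mathcomp Require Import all_classical all_reals all_analysis.
Set Implicit Arguments.
Unset Strict Implicit.
Unset Printing Implicit Defensive.
Import Order.TTheory GRing.Theory Num.Theory.
Import numFieldTopology.Exports numFieldNormedType.Exports.
Local Open Scope ring_scope.
Local Open Scope classical_set_scope.

(* A real Hilbert space is a complete normed module whose norm comes from a
   positive definite symmetric form.  Complex Hilbert spaces are covered by
   restriction of scalars (inner product Re<x,y>): norms, derivatives in a real
   variable, self-adjointness, positivity and square roots only involve the
   underlying real structure, and a self-adjoint operator has real spectrum. *)
Definition hilbert_norm (R : realType) (H : completeNormedModType R)
    (dot : {dot H for idfun}) : Prop :=
  forall x : H, `|x| = Num.sqrt (dot x x).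

Definition separable (T : topologicalType) : Prop :=
  exists D : set T, countable D /\ dense D.

(* An unbounded linear operator; the values of [op] outside [dom] are junk. *)
Record operator (R : realType) (H : completeNormedModType R) := Operator {
  dom : set H;
  op :> H -> H;
  dom0 : dom 0;
  domP : forall (k : R) x y, dom x -> dom y -> dom (k *: x + y);
  opP : forall (k : R) x y, dom x -> dom y -> op (k *: x + y) = k *: op x + op y
}.

Section Operators.
Variables (R : realType) (H : completeNormedModType R).
Variable dot : {dot H for idfun}.
Implicit Types A B S : operator H.

Definition op_eq A B : Prop :=
  dom A = dom B /\ forall x, dom A x -> A x = B x.

Definition comp_dom A B : set H := [set x | dom B x /\ dom A (B x)].

Lemma op0 A : A 0 = 0.
Proof.
have := opP 1 (dom0 A) (dom0 A); rewrite !scale1r add0r => /eqP.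
by rewrite -subr_eq0 opprD addNKr oppr_eq0 => /eqP.
Qed.

Lemma comp_dom0 A B : comp_dom A B 0.
Proof. by split; rewrite ?op0; exact: dom0. Qed.

Lemma comp_domP A B (k : R) x y :
  comp_dom A B x -> comp_dom A B y -> comp_dom A B (k *: x + y).
Proof.
by move=> [Bx ABx] [By ABy]; split; [exact: domP | rewrite opP//; exact: domP].
Qed.

Lemma comp_opP A B (k : R) x y : comp_dom A B x -> comp_dom A B y ->
  A (B (k *: x + y)) = k *: A (B x) + A (B y).
Proof. by move=> [Bx ABx] [By ABy]; rewrite !opP. Qed.

Definition op_comp A B : operator H :=
  @Operator R H (comp_dom A B) (fun x => A (B x))
    (comp_dom0 A B) (@comp_domP A B) (@comp_opP A B).

Definition densely_defined A : Prop := dense (dom A).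

Definition closed_op A : Prop :=
  closed [set p : H * H | dom A p.1 /\ p.2 = A p.1].

(* The right-hand side says that (y, z) lies in the graph of the adjoint. *)
Definition self_adjoint A : Prop :=
  densely_defined A /\
  forall y z, (dom A y /\ z = A y) <->
              (forall x, dom A x -> dot (A x) y = dot x z).

Definition nonneg_op A : Prop := forall x, dom A x -> 0 <= dot (A x) x.

Definition strictly_positive A : Prop :=
  forall x, dom A x -> x != 0 -> 0 < dot (A x) x.

Definition resolvent_set A : set R := [set l |
  exists T : {linear H -> H},
    [/\ continuous T,
        forall y, dom A (T y) /\ A (T y) - l *: T y = y &
        forall x, dom A x -> T (A x - l *: x) = x]].

Definition spectrum A : set R := ~` resolvent_set A.

Definition is_min_spectrum A (mu : R) : Prop :=
  spectrum A mu /\ lbound (spectrum A) mu.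

(* S = A^{1/2}, the unique nonnegative self-adjoint operator with S S = A. *)
Definition is_sqrt S A : Prop :=
  [/\ self_adjoint S, nonneg_op S & op_eq (op_comp S S) A].

Definition norm_controlled (C : R) A : Prop :=
  forall v, dom A v -> `|v| <= C * `|A v|.

End Operators.

(* States Psi = (psi, psi_t, psi_tt + c^2 A psi + b A psi_t). *)
Definition state (R : realType) (H : completeNormedModType R) : Type :=
  (H * H * H)%type.

Section PhaseSpaces.
Variables (R : realType) (H : completeNormedModType R).
Implicit Types (A S : operator H) (x : state H).

Definition H1 S : set (state H) := [set x | dom S x.1.1].

Definition normH1 S x : R :=
  Num.sqrt (`|S x.1.1| ^+ 2 + `|x.1.2| ^+ 2 + `|x.2| ^+ 2).

Definition H2 A : set (state H) := [set x | dom A x.1.1].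

Definition normH2 (alpha b : R) A x : R :=
  Num.sqrt (alpha ^+ 2 * b ^+ 2 / 4 * `|A x.1.1| ^+ 2
            + `|x.1.2| ^+ 2 + `|x.2| ^+ 2).

Definition gen_dom A : set (state H) :=
  [set x | [/\ dom A x.1.1, dom A x.1.2 & dom A x.2]].

Definition gen (a b c : R) A x : state H :=
  (x.1.2, - (c ^+ 2 *: A x.1.1) - b *: A x.1.2 + x.2, - (a *: A x.2)).

(* Continuity and differentiability are those of the phase space X with its
   norm N, not of the product topology on H * H * H. *)
Definition cont_within (N : state H -> R) (D : set R) (f : R -> state H)
    (t : R) : Prop :=
  N (f s - f t) @[s --> within D (nbhs t)] --> (0 : R).

Definition has_deriv (N : state H -> R) (f : R -> state H) (t : R)
    (d : state H) : Prop :=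
  N (h^-1 *: (f (h + t) - f t) - d) @[h --> (0 : R)^'] --> (0 : R).

(* Solutions of Psi_t = gen Psi (t > 0), Psi(0) = Psi0 in the phase space X
   with norm N.  Every Psi0 in X is the initial value for the data
   psi_0 = Psi0.1.1, psi_1 = Psi0.1.2 and
   psi_2 = Psi0.2 - c^2 A psi_0 - b A psi_1, the latter in general only in an
   extrapolation space. *)
Definition solution (a b c : R) A (X : set (state H)) (N : state H -> R)
    (Psi0 : state H) (Psi : R -> state H) : Prop :=
  [/\ forall t : R, 0 <= t -> X (Psi t),
      forall t : R, 0 <= t -> cont_within N [set s | 0 <= s] Psi t,
      exists dPsi : R -> state H, forall t : R, 0 < t ->
        [/\ X (dPsi t), has_deriv N Psi t (dPsi t),
            cont_within N [set s | 0 < s] dPsi t,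
            gen_dom A (Psi t) & dPsi t = gen a b c A (Psi t)] &
      Psi 0 = Psi0].

(* The energies of psi, read off from its state Psi.  For t > 0 the components
   are psi, psi_t and psi_tt + c^2 A psi + b A psi_t (see [E1_wave], [E2_wave]);
   at t = 0 they are the initial data, since psi_tt(0) need not exist in H. *)
Definition E1 S (Psi : R -> state H) (t : R) : R :=
  `|S (Psi t).1.1| ^+ 2 + `|(Psi t).1.2| ^+ 2 + `|(Psi t).2| ^+ 2.

Definition E2 A (Psi : R -> state H) (t : R) : R :=
  `|A (Psi t).1.1| ^+ 2 + `|(Psi t).1.2| ^+ 2 + `|(Psi t).2| ^+ 2.

Lemma cvg0_dominated (F : set_system R) {FF : ProperFilter F} (f : R -> H)
    (g : R -> R) (l : H) :
  (\forall s \near F, `|f s - l| <= g s) -> g @ F --> (0 : R) -> f @ F --> l.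
Proof.
move=> fg g0; apply/cvgrPdist_lt => e e0.
move/cvgr0Pnorm_lt: g0 => /(_ e e0) g0; near=> s.
rewrite distrC; apply: le_lt_trans (_ : g s < e); first by near: s.
apply: le_lt_trans (ler_norm _) _; near: s; exact: g0.
Unshelve. all: by end_near. Qed.

Lemma is_derive_cvg (f : R -> H) (t : R) (d : H) :
  h^-1 *: (f (h + t) - f t) @[h --> (0 : R)^'] --> d -> is_derive t 1 f d.
Proof.
move=> fd.
have fd' : h^-1 *: ((f \o shift t) (h *: (1 : R)) - f t)
    @[h --> (0 : R)^'] --> d.
  by under eq_fun do rewrite /= [_ *: 1]mulr1.
apply: DeriveDef; first by rewrite /derivable; apply/cvg_ex; exists d.
exact: cvg_lim fd'.
Qed.

Lemma near_shift_gt0 (t : R) : 0 < t -> \forall h \near (0 : R)^', 0 < h + t.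
Proof.
move=> t0; rewrite near_withinE; near=> h => _.
rewrite -ltrBlDr sub0r; near: h; apply: lt_nbhsr.
by rewrite oppr_lt0.
Unshelve. all: by end_near. Qed.

Section Wave.
Variables (a b c : R) (A : operator H) (X : set (state H)) (N : state H -> R).
Variable C : R.
Hypothesis XP :
  forall (k : R) x y, X x -> X y -> X (k *: x + y).
Hypothesis N1 : forall x, X x -> `|x.1.1| <= C * N x.
Hypothesis N2 : forall x, X x -> `|x.1.2| <= N x.
Variables (Psi0 : state H) (Psi : R -> state H).
Hypothesis sol : solution a b c A X N Psi0 Psi.

Let quot_in (t h : R) (d : state H) : 0 < t -> 0 < h + t -> X d ->
  X (h^-1 *: (Psi (h + t) - Psi t) - d).
Proof.
have [XPsi _ _ _] := sol => t0 ht0 Xd.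
rewrite addrC -scaleN1r; apply: XP => //.
have X0 : X 0 by rewrite -[0](subrr d) addrC -scaleN1r; exact: XP.
rewrite -[_ *: _]addr0; apply: XP => //.
by rewrite addrC -scaleN1r; apply: XP; apply: XPsi; exact: ltW.
Qed.

Lemma solution_derive (t : R) : 0 < t ->
  is_derive t 1 (fun s => (Psi s).1.1) (Psi t).1.2 /\
  is_derive t 1 (fun s => (Psi s).1.2)
    (- (c ^+ 2 *: A (Psi t).1.1) - b *: A (Psi t).1.2 + (Psi t).2).
Proof.
have [_ _ [dPsi HdPsi] _] := sol => t0.
have [Xd der _ _ dE] := HdPsi t t0.
have near_t := near_shift_gt0 t0.
split; apply: is_derive_cvg.
- have -> : (Psi t).1.2 = (dPsi t).1.1 by rewrite dE.
  apply: (@cvg0_dominated _ _ _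
    (fun h => C * N (h^-1 *: (Psi (h + t) - Psi t) - dPsi t))).
    near=> h; apply: (N1 (x := h^-1 *: (Psi (h + t) - Psi t) - dPsi t)).
    by apply: quot_in => //; near: h.
  by rewrite -[X in _ --> X](mulr0 C); exact: cvgMl_tmp der.
- have -> : - (c ^+ 2 *: A (Psi t).1.1) - b *: A (Psi t).1.2 + (Psi t).2 =
    (dPsi t).1.2 by rewrite dE.
  apply: (cvg0_dominated _ der).
  near=> h; apply: (N2 (x := h^-1 *: (Psi (h + t) - Psi t) - dPsi t)).
  by apply: quot_in => //; near: h.
Unshelve. all: by end_near. Qed.

Lemma solution_wave (t : R) (psi := fun s => (Psi s).1.1) : 0 < t ->
  (Psi t).1.2 = psi^`()%classic t /\
  (Psi t).2 = psi^`(2)%classic t + c ^+ 2 *: A (psi t) + b *: A (psi^`()%classic t).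
Proof.
have psi1 (s : R) : 0 < s -> psi^`()%classic s = (Psi s).1.2.
  by move=> /solution_derive[[_ <-] _]; rewrite derive1E.
move=> t0; rewrite psi1//; split=> //.
have -> : psi^`(2)%classic t = 'D_1 (fun s => (Psi s).1.2) t.
  rewrite derive1nS derive1n1 derive1E; apply: near_eq_derive.
  by near=> s; apply: psi1; near: s; exact: lt_nbhsr.
have [_ [_ ->]] := solution_derive t0.
set u := c ^+ 2 *: _; set v := b *: _.
by rewrite -addrA [LHS](_ : _ = (- u - v + (Psi t).2) + (u + v))//
  -opprD addrAC addNr add0r.
Unshelve. all: by end_near. Qed.

End Wave.

Let le_sqrt (x y : R) : 0 <= x -> x ^+ 2 <= y -> x <= Num.sqrt y.
Proof. by move=> x0 /ler_wsqrtr; rewrite sqrtr_sqr ger0_norm. Qed.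

Lemma E1_wave (a b c C : R) A S (Psi0 : state H) (Psi : R -> state H) (t : R)
    (psi := fun s => (Psi s).1.1) :
  norm_controlled C S -> solution a b c A (H1 S) (normH1 S) Psi0 Psi ->
  0 < t ->
  E1 S Psi t = `|S (psi t)| ^+ 2 + `|psi^`()%classic t| ^+ 2
    + `|psi^`(2)%classic t + c ^+ 2 *: A (psi t) + b *: A (psi^`()%classic t)|
      ^+ 2.
Proof.
move=> SC sol t0; have [|x Sx|x Sx|<- <- //] := solution_wave (C := `|C|) _ _ _ sol t0.
- by move=> k x y Sx Sy; exact: domP.
- apply: le_trans (SC _ Sx) _; apply: le_trans (ler_wpM2r _ (ler_norm C)) _ => //.
  rewrite ler_wpM2l//; apply: le_sqrt => //.
  by rewrite -addrA lerDl addr_ge0 ?sqr_ge0.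
- by apply: le_sqrt => //; rewrite -addrA addrCA lerDl addr_ge0 ?sqr_ge0.
Qed.

Lemma E2_wave (alpha a b c C : R) A (Psi0 : state H) (Psi : R -> state H)
    (t : R) (psi := fun s => (Psi s).1.1) :
  0 < alpha -> 0 < b -> norm_controlled C A ->
  solution a b c A (H2 A) (normH2 alpha b A) Psi0 Psi ->
  0 < t ->
  E2 A Psi t = `|A (psi t)| ^+ 2 + `|psi^`()%classic t| ^+ 2
    + `|psi^`(2)%classic t + c ^+ 2 *: A (psi t) + b *: A (psi^`()%classic t)|
      ^+ 2.
Proof.
move=> al0 b0 AC sol t0; pose k := alpha * b / 2.
have k0 : 0 < k by rewrite divr_gt0// mulr_gt0.
have k2 : alpha ^+ 2 * b ^+ 2 / 4 = k ^+ 2.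
  by rewrite /k !exprMn exprVn -natrX.
have [|x Ax|x Ax|<- <- //] := solution_wave (C := `|C| / k) _ _ _ sol t0.
- by move=> l x y Ax Ay; exact: domP.
- apply: le_trans (AC _ Ax) _; apply: le_trans (ler_wpM2r _ (ler_norm C)) _ => //.
  rewrite -mulrA ler_wpM2l// ler_pdivlMl// /normH2 k2 -exprMn.
  apply: le_sqrt; first by rewrite mulr_ge0// ltW.
  by rewrite -addrA lerDl addr_ge0 ?sqr_ge0.
- rewrite /normH2 k2; apply: le_sqrt => //; rewrite -addrA addrCA lerDl.
  by rewrite addr_ge0 ?sqr_ge0// mulr_ge0 ?sqr_ge0.
Qed.

End PhaseSpaces.

(* Main.v *)
(* Both estimates come from Lyapunov functionals.  Write (u, v, w) for the state,
   so that u' = v, v' = - c^2 A u - b A v + w, w' = - a A w, and P for a constant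
   with |x|^2 <= P |S x|^2.  With suitable e, K > 0 the functionals
     L1 = (c^2 + e b) |S u|^2 + |v|^2 + K |w|^2 + 2 e <u, v>
     L2 = |v + b A u|^2 + |v|^2 + K |w|^2 + 2 c^2 <A u, u>
   are comparable to E1 and E2.  In both derivatives the mixed terms in u and v
   cancel.  In L1' the term e <u, v> produces dissipation of |S u|^2; in L2' the
   term |v + b A u|^2 produces dissipation of |A u|^2, because
   (v + b A u)' = - c^2 A u + w no longer contains A v.  The couplings to w are
   absorbed by a large K, and Gronwall's inequality concludes. *)
Require Import Defs.
From HB Require Import structures.
From mathcomp Require Import all_boot all_order all_algebra.
From mathcomp Require Import all_classical all_reals all_analysis.
From mathcomp Require Import ring lra.
Import Order.TTheory GRing.Theory Num.Theory.
Import numFieldTopology.Exports numFieldNormedType.Exports.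
Local Open Scope ring_scope.
Local Open Scope classical_set_scope.
Set Implicit Arguments.
Unset Strict Implicit.
Unset Printing Implicit Defensive.

(** * Inner product algebra, Young's inequality and continuity of the form *)

Section InnerProduct.
Variables (R : realType) (H : completeNormedModType R) (dot : {dot H for idfun}).
Hypothesis hdot : hilbert_norm dot.
Implicit Types x y z : H.

Lemma dotC x y : dot x y = dot y x.
Proof. by rewrite hermC expr0 mul1r. Qed.

Lemma dot_norm x : dot x x = `|x| ^+ 2.
Proof.
rewrite hdot sqr_sqrtr//; have [->|x0] := eqVneq x 0; first by rewrite linear0l.
by rewrite ltW// neq0_dnorm_gt0.
Qed.

Lemma dotDl x y z : dot (x + y) z = dot x z + dot y z.
Proof. by rewrite linearDl. Qed.

Lemma dotDr x y z : dot x (y + z) = dot x y + dot x z.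
Proof. by rewrite linearDr. Qed.

Lemma dotNl x y : dot (- x) y = - dot x y.
Proof. by rewrite linearNl. Qed.

Lemma dotNr x y : dot x (- y) = - dot x y.
Proof. by rewrite linearNr. Qed.

Lemma dotZl k x y : dot (k *: x) y = k * dot x y.
Proof. by rewrite linearZl_LR. Qed.

Lemma dotZr k x y : dot x (k *: y) = k * dot x y.
Proof. by rewrite linearZr_LR. Qed.

Definition dotE := (dotDl, dotDr, dotNl, dotNr, dotZl, dotZr).

Lemma normD_sqr x y : `|x + y| ^+ 2 = `|x| ^+ 2 + 2 * dot x y + `|y| ^+ 2.
Proof. by rewrite -!dot_norm !dotE (dotC y x); ring. Qed.

(** Expand [0 <= |k x - y|^2] and divide by [k]. The free weight [k] decides which of the two
    factors pays for a mixed term. *)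
Lemma dot_young k x y : 0 < k ->
  2 * dot x y <= k * `|x| ^+ 2 + k^-1 * `|y| ^+ 2.
Proof.
move=> k0; have := sqr_ge0 `|k *: x - y|.
rewrite normD_sqr dotZl dotNr normrN normrZ (gtr0_norm k0) exprMn => h.
rewrite -subr_ge0 -(pmulr_rge0 _ k0) (le_trans h)// le_eqVlt; apply/orP; left.
by apply/eqP; field; rewrite gt_eqF.
Qed.

(** Polarization expresses [dot] through norms, so continuity of the norm suffices. *)
Lemma cvg_dot (T : Type) (F : set_system T) {FF : Filter F} (f g : T -> H) x y :
  f @ F --> x -> g @ F --> y -> dot (f s) (g s) @[s --> F] --> dot x y.
Proof.
have polar u v : dot u v = 4^-1 * (`|u + v| ^+ 2 - `|u - v| ^+ 2).
  by rewrite !normD_sqr dotNr normrN; field.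
move=> fx gy; rewrite polar; under eq_fun do rewrite polar.
apply: cvgMl_tmp; apply: cvgB.
- by rewrite expr2; under eq_fun do rewrite expr2;
    apply: cvgM; apply: cvg_norm; apply: cvgD.
- by rewrite expr2; under eq_fun do rewrite expr2;
    apply: cvgM; apply: cvg_norm; apply: cvgB.
Qed.

End InnerProduct.

(** * Differentiation rules for trajectories and the Gronwall argument *)

(** This is the regularity that a solution offers: differentiability for positive times, but at the
    initial time only continuity from the right. *)
Definition evolves (R : realType) (V : normedModType R) (f df : R -> V) : Prop :=
  (forall t : R, 0 <= t -> f @ within [set s | 0 <= s] (nbhs t) --> f t) /\
  (forall t : R, 0 < t -> is_derive t 1 f (df t)).

Section Evolves.
Variables (R : realType) (V : normedModType R).

Lemma evolvesD (f df g dg : R -> V) : evolves f df -> evolves g dg ->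
  evolves (fun t => f t + g t) (fun t => df t + dg t).
Proof.
move=> [fc fd] [gc gd]; split=> t t0; first by apply: cvgD; [exact: fc|exact: gc].
by have := fd t t0; have := gd t t0 => ? ?; exact: is_deriveD.
Qed.

Lemma evolvesZ k (f df : R -> V) : evolves f df ->
  evolves (fun t => k *: f t) (fun t => k *: df t).
Proof.
move=> [fc fd]; split=> t t0; first by apply: cvgZl_tmp; exact: fc.
by have := fd t t0 => ?; exact: is_deriveZ.
Qed.

End Evolves.

Lemma is_derive_quot (R : realType) (V : normedModType R) (f : R -> V) (t : R) d :
  is_derive t 1 f d <-> h^-1 *: (f (h + t) - f t) @[h --> 0^'] --> d.
Proof.
have -> : (fun h : R => h^-1 *: (f (h + t) - f t)) =
    fun h => h^-1 *: ((f \o shift t) (h *: (1 : R)) - f t).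
  by apply/funext => h; rewrite /= [_ *: 1]mulr1.
split=> [[df <-]//|fd]; apply: DeriveDef; last exact: cvg_lim fd.
by apply/cvg_ex; exists d.
Qed.

Section EvolvesDot.
Variables (R : realType) (H : completeNormedModType R) (dot : {dot H for idfun}).
Hypothesis hdot : hilbert_norm dot.

Lemma evolves_dot (f df g dg : R -> H) : evolves f df -> evolves g dg ->
  evolves (fun t => dot (f t) (g t))
          (fun t => dot (df t) (g t) + dot (f t) (dg t)).
Proof.
move=> [fc fd] [gc gd]; split=> t t0.
  by apply: (cvg_dot hdot); [exact: fc|exact: gc].
have dg1 : derivable g t 1 by have [] := gd t t0.
have /is_derive_quot qf := fd t t0; have /is_derive_quot qg := gd t t0.
apply/is_derive_quot.
have gt : g (e + t) @[e --> 0^'] --> g t.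
  have gt : {for t, continuous g}.
    by apply: differentiable_continuous; exact/derivable1_diffP.
  have et : e + t @[e --> 0^'] --> t.
    rewrite -[X in _ --> X]add0r.
    by apply: cvgD; [exact: cvg_within|exact: cvg_cst].
  exact: (cvg_comp _ _ et gt).
(* The difference quotient of the product is split as [<q_f(e), g(e + t)> + <f t, q_g(e)>], with
   [q_f], [q_g] the quotients of [f] and [g]. *)
apply: cvg_trans (cvgD (cvg_dot hdot qf gt) (cvg_dot hdot (cvg_cst (f t)) qg)).
apply: near_eq_cvg; near=> e => /=.
by rewrite fctE !dotE /GRing.scale/=; ring.
Unshelve. all: by end_near. Qed.

End EvolvesDot.

(** Since [L <= M E], the dissipation gives [L' <= - w L] with [w = d / M], so [exp(w t) L(t)] is
    nonincreasing. *)
Lemma lyapunov_decay (R : realType) (L dL E : R -> R) (m M d : R) :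
  0 < m -> 0 < M -> 0 < d -> evolves L dL ->
  (forall t : R, 0 <= t -> m * E t <= L t <= M * E t) ->
  (forall t : R, 0 < t -> dL t <= - d * E t) ->
  forall t : R, 0 <= t -> E t <= M / m * expR (- (d / M) * t) * E 0.
Proof.
move=> m0 M0 d0 [Lc Ld] LE dLE t t0.
set w := d / M.
have w0 : 0 < w by rewrite divr_gt0.
pose g s := expR (w * s) * L s.
have gd (s : R) : 0 < s -> is_derive s (1 : R) g (expR (w * s) * (w * L s + dL s)).
  move=> s0; have := Ld s s0 => Ls.
  have es : is_derive s (1 : R) (fun r => expR (w * r)) (w * expR (w * s)).
    have ws : is_derive s (1 : R) ( *%R w) w.
      have := @is_deriveZ _ _ _ (id : R -> R) w _ _ _ (is_derive_id s (1 : R)).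
      by rewrite [_ *: 1]mulr1.
    by have := is_derive1_comp (is_derive_expR (w * s)) ws; rewrite [_ * w]mulrC.
  rewrite (_ : g = (fun r => expR (w * r)) * L)//; apply: is_derive_eq.
  by rewrite /GRing.scale/=; ring.
(* The sign of the derivative is known on the open half-line only; continuity from the right carries
   the monotonicity down to time 0. *)
have gle : g t <= g 0.
  apply: (@ler0_derive1_nincry R g 0) => //.
  - by move=> x; rewrite in_itv/= andbT => /gd [].
  - move=> x; rewrite in_itv/= andbT => x0; have [_] := gd x x0.
    rewrite derive1E => ->.
    rewrite pmulr_rle0 ?expR_gt0//.
    have /andP[_ LM] := LE x (ltW x0); have := dLE x x0.
    have : w * L x <= d * E x.
      by rewrite /w mulrAC ler_pdivrMr// -mulrA (mulrC (E x)) ler_pM2l.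
    lra.
  - rewrite set_itvE; apply/subspace_continuousP => x x0.
    apply: cvgM; last exact: Lc.
    apply: cvg_within_filter; apply: continuous_comp; last exact: continuous_expR.
    exact: mulrl_continuous.
(* The conclusion is the chain [m E(t) exp(w t) <= g t <= g 0 = L(0) <= M E(0)]. *)
have /andP[Em _] := LE t t0; have /andP[_ EM] := LE 0 (lexx 0).
move: gle; rewrite /g mulr0 expR0 mul1r => gle.
have e0 := expR_gt0 (w * t).
rewrite mulNr expRN mulrAC ler_pdivlMr// (mulrAC M) ler_pdivlMr//.
nra.
Qed.

(* Unlike [cvg0_dominated], the filter need not be proper, so the lemma applies
   to [within] filters. *)
Lemma cvg_dominated (R : realType) (V : normedModType R) (T : Type)
    (F : set_system T) {FF : Filter F} (f : T -> V) (g : T -> R) (l : V) :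
  (\forall s \near F, `|f s - l| <= g s) -> g @ F --> (0 : R) -> f @ F --> l.
Proof.
move=> fg g0; apply/cvgrPdist_lt => e e0.
move/cvgr0Pnorm_lt: g0 => /(_ e e0) g0; near=> s.
rewrite distrC; apply: le_lt_trans (_ : g s < e); first by near: s.
by apply: le_lt_trans (ler_norm _) _; near: s.
Unshelve. all: by end_near. Qed.

(** * Square roots of operators and components of solutions *)

Section Operators.
Variables (R : realType) (H : completeNormedModType R) (dot : {dot H for idfun}).
Implicit Types (A B S : operator H).

Lemma self_adjoint_sym A x y : self_adjoint dot A -> dom A x -> dom A y ->
  dot (A x) y = dot x (A y).
Proof. by move=> [_ adj] Ax Ay; apply: (adj y (A y)).1. Qed.

Lemma is_sqrt_dom A S x : is_sqrt dot S A -> dom A x -> dom S x.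
Proof. by move=> [_ _ [<- _]] []. Qed.

(** One factor of [A = S S] moves across the inner product by symmetry of [S]. This turns [<A x, x>]
    into [|S x|^2]. *)
Lemma is_sqrt_dot A S x y : is_sqrt dot S A -> dom A x -> dom S y ->
  dot (A x) y = dot (S x) (S y).
Proof.
move=> [Ssa _ [domE SSE]] Ax Sy.
have [Sx SSx] : dom (op_comp S S) x by rewrite domE.
by rewrite -SSE ?domE//=; exact: self_adjoint_sym.
Qed.

(** The summand 1 makes the constant strictly positive whatever [C] is, so that it may serve as a
    divisor later. *)
Lemma norm_controlled_sqr C B x : norm_controlled C B -> dom B x ->
  `|x| ^+ 2 <= (C ^+ 2 + 1) * `|B x| ^+ 2.
Proof.
move=> CB /CB xB; have x0 := normr_ge0 x.
rewrite mulrDl mul1r (le_trans (_ : _ <= (C * `|B x|) ^+ 2))//.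
  by rewrite ler_sqr// nnegrE// (le_trans x0).
by rewrite exprMn lerDl sqr_ge0.
Qed.

(** Regularity in the phase norm passes to every component [k] bounded by that norm, because [k]
    commutes with difference quotients. Linearity is asked on [X] only, as [S] and [A] are
    meaningless off their domains. *)
Lemma solution_component (a b c C : R) A (X : set (state H)) (N : state H -> R)
    (k : state H -> H) Psi0 Psi :
  (forall l x y, X x -> X y -> X (l *: x + y)) ->
  (forall l x y, X x -> X y -> k (l *: x + y) = l *: k x + k y) ->
  (forall x, X x -> `|k x| <= C * N x) ->
  solution a b c A X N Psi0 Psi ->
  evolves (fun t => k (Psi t)) (fun t => k (gen a b c A (Psi t))).
Proof.
move=> XP kP kN [XPsi cPsi [dPsi dPsiP] _].
have XB x y : X x -> X y -> X (x - y).
  by move=> Xx Xy; rewrite addrC -scaleN1r; exact: XP.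
have kB x y : X x -> X y -> k (x - y) = k x - k y.
  by move=> Xx Xy; rewrite addrC -scaleN1r kP// scaleN1r addrC.
(* Nonemptiness of [X] comes from the solution itself. *)
have X0 : X 0 by rewrite -[0](subrr (Psi 0)); apply: XB; exact: XPsi.
have XZ l x : X x -> X (l *: x) by move=> Xx; rewrite -[_ *: _]addr0; exact: XP.
have k0 : k 0 = 0 by rewrite -[X in k X](subrr (0 : state H)) kB// subrr.
have kZ l x : X x -> k (l *: x) = l *: k x.
  by move=> Xx; rewrite -[l *: x]addr0 kP// k0 addr0.
split=> t t0.
  apply: (@cvg_dominated _ _ _ _ _ _ (fun s => C * N (Psi s - Psi t))).
    near=> s; have s0 : 0 <= s by near: s; exact: withinT.
    by rewrite -kB; [apply: kN; apply: XB| |]; exact: XPsi.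
  by rewrite -[X in _ --> X](mulr0 C); apply: cvgMl_tmp; exact: cPsi.
have [Xd der _ _ <-] := dPsiP t t0.
apply/is_derive_quot.
apply: (@cvg_dominated _ _ _ _ _ _
  (fun h => C * N (h^-1 *: (Psi (h + t) - Psi t) - dPsi t))).
  near=> h.
  have ht : 0 <= h + t by rewrite ltW//; near: h; exact: near_shift_gt0.
  have XD : X (Psi (h + t) - Psi t) by apply: XB; apply: XPsi => //; exact: ltW.
  have XQ : X (h^-1 *: (Psi (h + t) - Psi t)) by exact: XZ.
  have -> : k (Psi (h + t)) - k (Psi t) = k (Psi (h + t) - Psi t).
    by rewrite kB//; apply: XPsi => //; exact: ltW.
  by rewrite -kZ// -kB//; apply: kN; exact: XB.
by rewrite -[X in _ --> X](mulr0 C); apply: cvgMl_tmp; exact: der.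
Unshelve. all: by end_near. Qed.

End Operators.

(** * Components bounded by the phase space norms *)

Section PhaseNorms.
Variables (R : realType) (H : completeNormedModType R).

Let le_sqrt (x y : R) : 0 <= x -> x ^+ 2 <= y -> x <= Num.sqrt y.
Proof. by move=> x0 /ler_wsqrtr; rewrite sqrtr_sqr ger0_norm. Qed.

Lemma normH1_ge (S : operator H) (x : state H) :
  [/\ `|S x.1.1| <= normH1 S x, `|x.1.2| <= normH1 S x & `|x.2| <= normH1 S x].
Proof.
have := sqr_ge0 `|S x.1.1|; have := sqr_ge0 `|x.1.2|; have := sqr_ge0 `|x.2|.
by split; apply: le_sqrt => //; lra.
Qed.

Lemma normH2_ge alpha b (A : operator H) (x : state H) : 0 < alpha * b ->
  [/\ `|A x.1.1| <= 2 / (alpha * b) * normH2 alpha b A x,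
     `|x.1.2| <= normH2 alpha b A x & `|x.2| <= normH2 alpha b A x].
Proof.
move=> ab0; rewrite /normH2.
have -> : alpha ^+ 2 * b ^+ 2 / 4 * `|A x.1.1| ^+ 2
    = (alpha * b / 2 * `|A x.1.1|) ^+ 2 by field.
have Ax0 : 0 <= alpha * b / 2 * `|A x.1.1| by rewrite mulr_ge0// divr_ge0// ltW.
have := sqr_ge0 (alpha * b / 2 * `|A x.1.1|).
have := sqr_ge0 `|x.1.2|; have := sqr_ge0 `|x.2| => *.
split; [rewrite -invf_div ler_pdivlMl ?divr_gt0//|..];
  by apply: le_sqrt => //; lra.
Qed.

End PhaseNorms.

(** * Decay of the first energy *)

Section Decay.
Variables (R : realType) (H : completeNormedModType R) (dot : {dot H for idfun}).
Hypothesis hdot : hilbert_norm dot.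
Variables (A S : operator H) (a b c : R).
Hypotheses (ha : 0 < a) (hb : 0 < b) (hc : 0 < c) (hS : is_sqrt dot S A).
Variable C12 : R.
Hypothesis hC12 : norm_controlled C12 S.

Lemma E1_decay : exists M w : R, [/\ 0 < M, 0 < w &
  forall (Psi0 : state H) (Psi : R -> state H),
    solution a b c A (H1 S) (normH1 S) Psi0 Psi ->
    forall t : R, 0 <= t -> E1 S Psi t <= M * expR (- w * t) * E1 S Psi 0].
Proof.
pose P := C12 ^+ 2 + 1.
have P0 : 0 < P by rewrite ltr_wpDl ?sqr_ge0.
(* These are Young weights with [k1 |v|^2 <= b |S v|^2] and [k2 |u|^2 <= c^2 |S u|^2]. The factor 4
   in [e] lets [2 e |v|^2] use up only [k1 |v|^2 / 2]. *)
pose k1 := b / P; pose k2 := c ^+ 2 / P; pose e := k1 / 4.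
have c20 : 0 < c ^+ 2 by rewrite exprn_gt0.
have k10 : 0 < k1 by rewrite divr_gt0.
have k20 : 0 < k2 by rewrite divr_gt0.
have e0 : 0 < e by rewrite divr_gt0.
(* [r] collects the [|w|^2] terms of both Young inequalities. [K] is such that half of the
   dissipation [2 K a |S w|^2] absorbs them and the other half remains. *)
pose r := k1^-1 + e * k2^-1.
have r0 : 0 < r by rewrite addr_gt0 ?mulr_gt0 ?invr_gt0.
pose K := P * r / a.
have K0 : 0 < K by rewrite divr_gt0 ?mulr_gt0.
have k1P : k1 * P = b by rewrite divfK ?gt_eqF.
have k2P : k2 * P = c ^+ 2 by rewrite divfK ?gt_eqF.
have Ka : K * a = P * r by rewrite divfK ?gt_eqF.
pose m := Num.min (c ^+ 2) (Num.min 2^-1 K).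
pose M := c ^+ 2 + 2 * e * b + 2 + K.
pose d := Num.min (k1 / 2) (Num.min (e * c ^+ 2) r).
have m0 : 0 < m by rewrite !lt_min c20 K0 invr_gt0 ltr0n.
have eb0 : 0 < e * b by rewrite mulr_gt0.
have M0 : 0 < M by rewrite /M; lra.
have d0 : 0 < d by rewrite !lt_min r0 divr_gt0//= mulr_gt0.
exists (M / m), (d / M); split; [exact: divr_gt0|exact: divr_gt0|].
move=> Psi0 Psi sol.
have XP l x y : H1 S x -> H1 S y -> H1 S (l *: x + y) by exact: domP.
pose u t := (Psi t).1.1; pose v t := (Psi t).1.2; pose w t := (Psi t).2.
have Su_evol : evolves (fun t => S (u t)) (fun t => S (v t)).
  apply: (solution_component (C := 1) (k := fun x => S x.1.1) XP _ _ sol).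
    by move=> l x y; exact: opP.
  by move=> x _; rewrite mul1r; have [] := normH1_ge S x.
have u_evol : evolves u v.
  apply: (solution_component (C := `|C12|) (k := fun x => x.1.1) XP _ _ sol) => //.
  move=> x /hC12 /le_trans; apply; apply: le_trans (ler_wpM2r _ (ler_norm _)) _ => //.
  by rewrite ler_wpM2l//; have [] := normH1_ge S x.
have v_evol : evolves v (fun t => (gen a b c A (Psi t)).1.2).
  apply: (solution_component (C := 1) (k := fun x => x.1.2) XP _ _ sol) => //.
  by move=> x _; rewrite mul1r; have [] := normH1_ge S x.
have w_evol : evolves w (fun t => (gen a b c A (Psi t)).2).
  apply: (solution_component (C := 1) (k := fun x => x.2) XP _ _ sol) => //.
  by move=> x _; rewrite mul1r; have [] := normH1_ge S x.
(* In L1 the coefficient [c^2 + e b] of [|S u|^2] has two parts: [c^2] cancels the [<S u, S v>] term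
   from [|v|^2], and [e b] the one from [2 e <u, v>]. *)
have L_evol := evolvesD (evolvesD (evolvesD
  (evolvesZ (c ^+ 2 + e * b) (evolves_dot hdot Su_evol Su_evol))
  (evolves_dot hdot v_evol v_evol))
  (evolvesZ K (evolves_dot hdot w_evol w_evol)))
  (evolvesZ (2 * e) (evolves_dot hdot u_evol v_evol)).
have U_le t : 0 <= t -> `|u t| ^+ 2 <= P * `|S (u t)| ^+ 2.
  by have [XPsi _ _ _] := sol => /XPsi; exact: norm_controlled_sqr.
apply: (lyapunov_decay m0 M0 d0 L_evol) => t t0.
  rewrite /E1 -/(u t) -/(v t) -/(w t) /GRing.scale/= !dot_norm//.
  have := U_le _ t0.
  have e20 : 0 < 2 * e by rewrite mulr_gt0.
  (* Young for both [u] and [- u] bounds the mixed term from above and below. With weight [2 e] it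
     costs [|v|^2 / 2]. *)
  have := dot_young hdot (u t) (v t) e20; have := dot_young hdot (- u t) (v t) e20.
  rewrite dotNl normrN.
  set U := `|u t| ^+ 2; set V := `|v t| ^+ 2; set W := `|w t| ^+ 2.
  set X := `|S (u t)| ^+ 2; set uv := dot _ _ => uv1 uv2 UX.
  have [X0 V0 W0] : [/\ 0 <= X, 0 <= V & 0 <= W] by rewrite !sqr_ge0.
  have eV : e * ((2 * e)^-1 * V) = V / 2 by field; rewrite gt_eqF.
  move: uv1 uv2; rewrite -(ler_pM2l e0) -[in X in _ -> X](ler_pM2l e0).
  rewrite !mulrDr eV => uv1 uv2.
  (* As [e = k1 / 4] and [k1 P = b], the cost in [u] is at most half of the [e b |S u|^2] present in
     L1. *)
  have eU : e * (2 * e * U) <= e * b / 2 * X.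
    have -> : e * b / 2 * X = 2 * e ^+ 2 * (P * X) by rewrite -k1P /e; field.
    have -> : e * (2 * e * U) = 2 * e ^+ 2 * U by ring.
    by rewrite ler_pM2l// mulr_gt0// exprn_gt0.
  have mX : m * X <= c ^+ 2 * X by rewrite ler_wpM2r// !ge_min lexx.
  have mV : m * V <= 2^-1 * V by rewrite ler_wpM2r// !ge_min lexx orbT.
  have mW : m * W <= K * W by rewrite ler_wpM2r// !ge_min lexx !orbT.
  have ebX : 0 <= e * b * X by rewrite mulr_ge0// ltW.
  have ebV : 0 <= e * b * V by rewrite mulr_ge0// ltW.
  have ebW : 0 <= e * b * W by rewrite mulr_ge0// ltW.
  have KX : 0 <= K * X by rewrite mulr_ge0// ltW.
  have KV : 0 <= K * V by rewrite mulr_ge0// ltW.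
  have cV : 0 <= c ^+ 2 * V by rewrite mulr_ge0// ltW.
  have cW : 0 <= c ^+ 2 * W by rewrite mulr_ge0// ltW.
  by rewrite /M; apply/andP; split; lra.
have [XPsi _ [dPsi dPsiP] _] := sol.
have [_ _ _ [uA vA wA] _] := dPsiP t t0.
have [uS vS wS] := And3 (is_sqrt_dom hS uA) (is_sqrt_dom hS vA) (is_sqrt_dom hS wA).
rewrite /gen/= -/(u t) -/(v t) -/(w t) /E1 -/(u t) -/(v t) -/(w t) /GRing.scale/=.
rewrite !dotE (dotC dot (v t) (A (u t))) (dotC dot (v t) (A (v t))).
rewrite (dotC dot (w t) (A (w t))).
rewrite (dotC dot (u t) (A (u t))) (dotC dot (u t) (A (v t))) (dotC dot (w t) (v t)).
rewrite !(is_sqrt_dot hS)// !dot_norm// (dotC dot (S (v t))).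
have := U_le _ (ltW t0).
have := norm_controlled_sqr hC12 vS; have := norm_controlled_sqr hC12 wS.
have := dot_young hdot (v t) (w t) k10; have := dot_young hdot (u t) (w t) k20.
rewrite -/(v t) -/(w t) -/P.
set U := `|u t| ^+ 2; set V := `|v t| ^+ 2; set W := `|w t| ^+ 2.
set X := `|S (u t)| ^+ 2; set Y := `|S (v t)| ^+ 2; set Z := `|S (w t)| ^+ 2.
set uw := dot (u t) _; set vw := dot (v t) _; set uv := dot _ _.
move=> uw_le vw_le WZ VY UX.
have [X0 V0 W0] : [/\ 0 <= X, 0 <= V & 0 <= W] by rewrite !sqr_ge0.
have dX : d * X <= e * c ^+ 2 * X by rewrite ler_wpM2r// !ge_min lexx orbT.
have dV : d * V <= k1 / 2 * V by rewrite ler_wpM2r// !ge_min lexx.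
have dW : d * W <= r * W by rewrite ler_wpM2r// !ge_min lexx !orbT.
have bY : k1 * V <= b * Y by rewrite -k1P -mulrA ler_pM2l.
have cX : e * (k2 * U) <= e * c ^+ 2 * X.
  by rewrite -k2P -mulrA ler_pM2l// -mulrA ler_pM2l.
have KZ : r * W <= K * a * Z by rewrite Ka (mulrC P) -mulrA ler_pM2l.
have : e * (2 * uw) <= e * (k2 * U + k2^-1 * W) by rewrite ler_pM2l.
have eV : e * V = k1 * V / 4 by rewrite /e; ring.
have rW : r * W = k1^-1 * W + e * (k2^-1 * W) by rewrite /r; ring.
(* After the cancellations, L1' is [- 2 b Y - 2 K a Z - 2 e c^2 X + 2 e V + 2 vw + 2 e uw]. The
   bounds above leave at most [- (k1 / 2) V - e c^2 X - r W]. *)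
lra.
Qed.

(** * Decay of the second energy *)

Variables (C1 alpha : R).
Hypotheses (hsa : self_adjoint dot A) (hC1 : norm_controlled C1 A).
Hypothesis halpha : 0 < alpha.

Lemma E2_decay : exists M w : R, [/\ 0 < M, 0 < w &
  forall (Psi0 : state H) (Psi : R -> state H),
    solution a b c A (H2 A) (normH2 alpha b A) Psi0 Psi ->
    forall t : R, 0 <= t -> E2 A Psi t <= M * expR (- w * t) * E2 A Psi 0].
Proof.
pose P := C12 ^+ 2 + 1; pose Q := C1 ^+ 2 + 1.
have P0 : 0 < P by rewrite ltr_wpDl ?sqr_ge0.
have Q0 : 0 < Q by rewrite ltr_wpDl ?sqr_ge0.
(* The coupling [<v, w>] arises twice, from [v + b A u] and from [v]. Young then costs [2 k |v|^2],
   which is at most [b |S v|^2]. *)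
pose k := b / (2 * P).
have c20 : 0 < c ^+ 2 by rewrite exprn_gt0.
have b20 : 0 < b ^+ 2 by rewrite exprn_gt0.
have k0 : 0 < k by rewrite divr_gt0 ?mulr_gt0.
pose r := 2 * k^-1 + b * (c ^+ 2)^-1.
have r0 : 0 < r by rewrite addr_gt0 ?mulr_gt0 ?invr_gt0.
pose K := P * r / a.
have K0 : 0 < K by rewrite divr_gt0 ?mulr_gt0.
have kP : 2 * k * P = b by rewrite mulrAC mulrC divfK// gt_eqF// mulr_gt0.
have Ka : K * a = P * r by rewrite divfK ?gt_eqF.
have cQ0 : 0 < c ^+ 2 * Q by rewrite mulr_gt0.
pose m := Num.min (b ^+ 2 / 4) (Num.min 2^-1 K).
pose M := 3 + 2 * b ^+ 2 + K + c ^+ 2 + c ^+ 2 * Q.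
pose d := Num.min (b * c ^+ 2) (Num.min (2 * k) r).
have m0 : 0 < m by rewrite !lt_min K0 invr_gt0 ltr0n divr_gt0.
have M0 : 0 < M by rewrite /M; lra.
have d0 : 0 < d by rewrite !lt_min r0 andbT; apply/andP; split; apply: mulr_gt0.
have ab0 : 0 < alpha * b by rewrite mulr_gt0.
exists (M / m), (d / M); split; [exact: divr_gt0|exact: divr_gt0|].
move=> Psi0 Psi sol.
have XP l x y : H2 A x -> H2 A y -> H2 A (l *: x + y) by exact: domP.
pose u t := (Psi t).1.1; pose v t := (Psi t).1.2; pose w t := (Psi t).2.
have Au_evol : evolves (fun t => A (u t)) (fun t => A (v t)).
  apply: (solution_component (k := fun x => A x.1.1) XP _ _ sol).
    by move=> l x y; exact: opP.
  by move=> x _; have [+ _ _] := normH2_ge A x ab0; exact.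
have u_evol : evolves u v.
  apply: (solution_component (C := `|C1| * (2 / (alpha * b)))
    (k := fun x => x.1.1) XP _ _ sol) => //.
  move=> x /hC1 /le_trans; apply; apply: le_trans (ler_wpM2r _ (ler_norm _)) _ => //.
  by rewrite -mulrA ler_wpM2l//; have [] := normH2_ge A x ab0.
have v_evol : evolves v (fun t => (gen a b c A (Psi t)).1.2).
  apply: (solution_component (C := 1) (k := fun x => x.1.2) XP _ _ sol) => //.
  by move=> x _; rewrite mul1r; have [] := normH2_ge A x ab0.
have w_evol : evolves w (fun t => (gen a b c A (Psi t)).2).
  apply: (solution_component (C := 1) (k := fun x => x.2) XP _ _ sol) => //.
  by move=> x _; rewrite mul1r; have [] := normH2_ge A x ab0.
have q_evol := evolvesD v_evol (evolvesZ b Au_evol).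
have L_evol := evolvesD (evolvesD (evolvesD
  (evolves_dot hdot q_evol q_evol)
  (evolves_dot hdot v_evol v_evol))
  (evolvesZ K (evolves_dot hdot w_evol w_evol)))
  (evolvesZ (2 * c ^+ 2) (evolves_dot hdot Au_evol u_evol)).
have [XPsi _ [dPsi dPsiP] _] := sol.
apply: (lyapunov_decay m0 M0 d0 L_evol) => t t0.
  have uA := XPsi t t0; have uS := is_sqrt_dom hS uA.
  rewrite /E2 -/(u t) -/(v t) -/(w t) /GRing.scale/= !dot_norm//.
  have := dot_young hdot (A (u t)) (u t) ltr01.
  (* yields |v + b A u|^2 + |v|^2 >= |v|^2 / 2 + b^2 |A u|^2 / 4 *)
  have := sqr_ge0 `|3 *: v t + (2 * b) *: A (u t)|.
  (* This one yields the upper bound [|v + b A u|^2 <= 2 |v|^2 + 2 b^2 |A u|^2]. *)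
  have := sqr_ge0 `|v t - b *: A (u t)|.
  rewrite !(normD_sqr hdot) !dotE normrN !normrZ !exprMn !real_normK ?num_real//.
  have := norm_controlled_sqr hC1 uA; rewrite -/Q -/(u t).
  have : 0 <= dot (A (u t)) (u t) by rewrite (is_sqrt_dot hS)// dot_norm// sqr_ge0.
  set U := `|u t| ^+ 2; set V := `|v t| ^+ 2; set W := `|w t| ^+ 2.
  set X := `|A (u t)| ^+ 2; set vu := dot (v t) _; set uu := dot _ _.
  move=> uu0 UX vu_le vu_ge uu_le.
  have [X0 V0 W0] : [/\ 0 <= X, 0 <= V & 0 <= W] by rewrite !sqr_ge0.
  have mX : m * X <= b ^+ 2 / 4 * X by rewrite ler_wpM2r// !ge_min lexx.
  have mV : m * V <= 2^-1 * V by rewrite ler_wpM2r// !ge_min lexx orbT.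
  have mW : m * W <= K * W by rewrite ler_wpM2r// !ge_min lexx !orbT.
  have cuu0 : 0 <= c ^+ 2 * uu by rewrite mulr_ge0// ltW.
  have cuu : c ^+ 2 * (2 * uu) <= c ^+ 2 * (X + Q * X) by rewrite ler_pM2l//; lra.
  have bX : 0 <= b ^+ 2 * X by rewrite mulr_ge0// ltW.
  have bV : 0 <= b ^+ 2 * V by rewrite mulr_ge0// ltW.
  have bW : 0 <= b ^+ 2 * W by rewrite mulr_ge0// ltW.
  have KX : 0 <= K * X by rewrite mulr_ge0// ltW.
  have KV : 0 <= K * V by rewrite mulr_ge0// ltW.
  have cV : 0 <= c ^+ 2 * V by rewrite mulr_ge0// ltW.
  have cW : 0 <= c ^+ 2 * W by rewrite mulr_ge0// ltW.
  have cQV : 0 <= c ^+ 2 * Q * V by rewrite mulr_ge0// ltW.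
  have cQW : 0 <= c ^+ 2 * Q * W by rewrite mulr_ge0// ltW.
  by rewrite /M; apply/andP; split; lra.
have [_ _ _ [uA vA wA] _] := dPsiP t t0.
have [uS vS wS] := And3 (is_sqrt_dom hS uA) (is_sqrt_dom hS vA) (is_sqrt_dom hS wA).
rewrite /gen/= -/(u t) -/(v t) -/(w t) /E2 -/(u t) -/(v t) -/(w t) /GRing.scale/=.
(* By symmetry of [A], the derivative of [2 c^2 <A u, u>] is [4 c^2 <A u, v>]. It cancels the two
   terms [- 2 c^2 <A u, v>] from [|v + b A u|^2] and [|v|^2]. *)
rewrite !dotE (self_adjoint_sym hsa vA uA) -/(u t) -/(v t).
rewrite (dotC dot (v t) (A (u t))) (dotC dot (v t) (A (v t))).
rewrite (dotC dot (A (v t)) (A (u t))) (dotC dot (w t) (A (w t))).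
rewrite (dotC dot (w t) (v t)) (dotC dot (w t) (A (u t))).
rewrite !(is_sqrt_dot hS vA)// !(is_sqrt_dot hS wA)// !dot_norm//.
have := norm_controlled_sqr hC12 vS; have := norm_controlled_sqr hC12 wS.
have := dot_young hdot (v t) (w t) k0; have := dot_young hdot (A (u t)) (w t) c20.
rewrite -/(u t) -/(v t) -/(w t) -/P.
set V := `|v t| ^+ 2; set W := `|w t| ^+ 2.
set X := `|A (u t)| ^+ 2; set Y := `|S (v t)| ^+ 2; set Z := `|S (w t)| ^+ 2.
set uw := dot (A (u t)) (w t); set vw := dot (v t) (w t).
set uv := dot (A (u t)) (v t); set Auv := dot (A (u t)) (A (v t)).
move=> uw_le vw_le WZ VY.
have [X0 V0 W0] : [/\ 0 <= X, 0 <= V & 0 <= W] by rewrite !sqr_ge0.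
have dX : d * X <= b * c ^+ 2 * X by rewrite ler_wpM2r// !ge_min lexx.
have dV : d * V <= 2 * k * V by rewrite ler_wpM2r// !ge_min lexx orbT.
have dW : d * W <= r * W by rewrite ler_wpM2r// !ge_min lexx !orbT.
have bY : 2 * k * V <= b * Y by rewrite -kP -(mulrA _ P) ler_pM2l// mulr_gt0.
have KZ : r * W <= K * a * Z by rewrite Ka (mulrC P) -mulrA ler_pM2l.
have : b * (2 * uw) <= b * (c ^+ 2 * X + (c ^+ 2)^-1 * W) by rewrite ler_pM2l.
have rW : r * W = 2 * (k^-1 * W) + b * ((c ^+ 2)^-1 * W) by rewrite /r; ring.
(* What remains of L2' is [- 2 b c^2 X - 2 b Y - 2 K a Z + 4 vw + 2 b uw], hence at most
   [- b c^2 X - 2 k V - r W]. *)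
lra.
Qed.

End Decay.

Theorem theorem3p12 (R : realType) (H : completeNormedModType R)
    (dot : {dot H for idfun}) (hdot : hilbert_norm dot) (hsep : separable H)
    (A S : operator H)
    (hdense : densely_defined A) (hclosed : closed_op A)
    (hsa : self_adjoint dot A) (hpos : strictly_positive dot A)
    (mu : R) (hmu : is_min_spectrum A mu) (hmu0 : 0 < mu)
    (hS : is_sqrt dot S A)
    (C12 C1 C32 : R) (hC12 : norm_controlled C12 S)
    (hC1 : norm_controlled C1 A) (hC32 : norm_controlled C32 (op_comp A S))
    (a b c alpha : R) (ha : 0 < a) (hb : 0 < b) (hc : 0 < c)
    (halpha : 0 < alpha) :
  exists M1 M2 omega1 omega2 : R,
    [/\ 0 < M1, 0 < M2, 0 < omega1 & 0 < omega2] /\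
    (forall (Psi0 : state H) (Psi : R -> state H),
        H1 S Psi0 ->
        solution a b c A (H1 S) (normH1 S) Psi0 Psi ->
        forall t : R, 0 <= t ->
          E1 S Psi t <= M1 * expR (- omega1 * t) * E1 S Psi 0) /\
    (forall (Psi0 : state H) (Psi : R -> state H),
        H2 A Psi0 ->
        solution a b c A (H2 A) (normH2 alpha b A) Psi0 Psi ->
        forall t : R, 0 <= t ->
          E2 A Psi t <= M2 * expR (- omega2 * t) * E2 A Psi 0).
Proof.
have [M1 [w1 [M10 w10 E1_le]]] := E1_decay hdot ha hb hc hS hC12.
have [M2 [w2 [M20 w20 E2_le]]] := E2_decay hdot ha hb hc hS hC12 hsa hC1 halpha.
exists M1, M2, w1, w2; split=> //; split=> Psi0 Psi _.
- exact: E1_le.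
- exact: E2_le.
Qed.
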